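(* Let $p$ be a fixed odd prime, let $\lambda\in\mathbb{Z}_p$, let $q\in\mathbb{C}_p$ with $|1-q|_p<p^{-1/(p-1)}$, and let $t\in\mathbb{C}_p$ with $|t|_p<p^{-1/(p-1)}|q|_p$. Let $F(t,x|\lambda)=\sum_{n=0}^\infty Bl_{n,q}(x|\lambda)\frac{t^n}{n!}$, where $Bl_{n,q}(x|\lambda)$ are the Boole polynomials with $q$-parameter in the variable $x$. Then $$F(t,x|\lambda)=\left(\frac{2}{(1+qt)^{\lambda/q}+1}\right)(1+qt)^{x/q}.$$
   Context: $\mathbb{Z}_p$ is the ring of $p$-adic integers and $\mathbb{C}_p$ is the completion of an algebraic closure of the field $\mathbb{Q}_p$ of $p$-adic numbers, with norm normalized by $|p|_p=1/p$. For a continuous function $f$ on $\mathbb{Z}_p$, the fermionic $p$-adic integral is $$\int_{\mathbb{Z}_p} f(y)\,d\mu_{-1}(y)=\lim_{N\to\infty}\sum_{y=0}^{p^N-1}f(y)(-1)^y.$$ The $q$-product is $(z)_{n,q}=z(z-q)(z-2q)\cdots(z-(n-1)q)$ for $n\ge 0$, with $(z)_{0,q}=1$. The Boole polynomials with $q$-parameter are defined by $$Bl_{n,q}(x|\lambda)=\int_{\mathbb{Z}_p}(x+\lambda y)_{n,q}\,d\mu_{-1}(y)\quad(n\ge 0).$$ The powers are given by the binomial series $(1+qt)^a=\sum_{n\ge0}\binom{a}{n}q^nt^n$, where $\binom{a}{n}=a(a-1)\cdots(a-n+1)/n!$. *)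

(* Defs.v *)
From HB Require Import structures.
From mathcomp Require Import all_boot all_order all_algebra.
From mathcomp Require Import all_classical all_reals all_analysis.

Set Implicit Arguments.
Unset Strict Implicit.
Unset Printing Implicit Defensive.

Import Order.TTheory GRing.Theory Num.Theory.

Local Open Scope classical_set_scope.
Local Open Scope ring_scope.

(* Num.norm cannot serve here: every normedZmodType satisfies
   `|x *+ n| = `|x| *+ n, which contradicts |p| = 1/p. *)
HB.mixin Record isUltrametricField (R : realType) K & GRing.Field K := {
  vnorm : K -> R;
  vnorm_ge0 : forall x, 0 <= vnorm x;
  vnorm_eq0 : forall x, (vnorm x == 0) = (x == 0);
  vnormM : forall x y, vnorm (x * y) = vnorm x * vnorm y;
  vnormD_max : forall x y, vnorm (x + y) <= Num.max (vnorm x) (vnorm y)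
}.

#[short(type="ultrametricFieldType")]
HB.structure Definition UltrametricField (R : realType) :=
  {K of isUltrametricField R K & GRing.Field K}.

(* K with the topology of the distance |x - y|; an alias, because a structure
   extending both GRing.Field and Metric would need joins absent from the
   hierarchy. *)
Definition vmetric (R : realType) (K : ultrametricFieldType R) : Type := K.

Section Metric.
Variables (R : realType) (K : ultrametricFieldType R).

Let dist (x y : K) : R := vnorm (x - y).

Let dist_xx x : dist x x = 0.
Proof. by apply/eqP; rewrite /dist vnorm_eq0 subrr. Qed.

Let dist_eq0 x y : dist x y = 0 -> x = y.
Proof. by move=> /eqP; rewrite /dist vnorm_eq0 subr_eq0 => /eqP. Qed.

Let vnorm1 : vnorm (1 : K) = 1 :> R.
Proof.
have n1 : vnorm (1 : K) != 0 :> R by rewrite vnorm_eq0 oner_neq0.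
by apply: (mulfI n1); rewrite -vnormM !mulr1.
Qed.

Let vnormN1 : vnorm (-1 : K) = 1 :> R.
Proof.
apply/eqP; rewrite -(@eqrXn2 _ 2%N) ?vnorm_ge0 ?ler01 //.
by rewrite expr1n expr2 -vnormM mulrNN mulr1 vnorm1.
Qed.

Let dist_sym x y : dist x y = dist y x.
Proof. by rewrite /dist -opprB -mulN1r vnormM vnormN1 mul1r. Qed.

Let dist_triangle y x z : dist x z <= dist x y + dist y z.
Proof.
have -> : dist x z = vnorm ((x - y) + (y - z)) by rewrite /dist addrA subrK.
apply: le_trans (vnormD_max _ _) _.
by rewrite ge_max lerDl lerDr !vnorm_ge0.
Qed.

HB.instance Definition _ := Choice.copy (vmetric K) K.
HB.instance Definition _ := isPointed.Build (vmetric K) (0 : K).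
HB.instance Definition _ :=
  isMetric.Build R (vmetric K) dist_xx dist_eq0 dist_sym dist_triangle.

End Metric.

Notation vcvg u := (cvgn (u : nat -> vmetric _)).
Notation vlim u := (limn (u : nat -> vmetric _)).

(* When K is complete and |.| is the p-adic absolute value on the rationals, the
   closure of the rationals in K is their completion, that is, Q_p. *)
Definition padic_num (R : realType) (K : ultrametricFieldType R) : set K :=
  closure (range (@ratr K) : set (vmetric K)).

Definition padic_int (R : realType) (K : ultrametricFieldType R) : set K :=
  [set x : K | padic_num x /\ vnorm x <= 1].

Definition algebraic_over (K : fieldType) (k : set K) : set K :=
  [set x | exists P : {poly K}, [/\ P != 0, forall i, k P`_i & root P x]].

(* K is a completion of an algebraic closure of Q_p, normalized by |p| = 1/p;
   this determines K up to isometric isomorphism. The algebraic closure is the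
   set of elements of K that are algebraic over Q_p, which has to be
   algebraically closed. *)
Record is_Cp (p : nat) (R : realType) (K : ultrametricFieldType R) : Prop := {
  Cp_norm_p : vnorm (p%:R : K) = p%:R^-1 :> R;
  Cp_closed : forall P : {poly K},
    (forall i, algebraic_over (@padic_num R K) P`_i) -> (1 < size P)%N ->
    exists2 x : K, algebraic_over (@padic_num R K) x & root P x;
  Cp_dense : dense (algebraic_over (@padic_num R K) : set (vmetric K));
  Cp_complete : forall F : set_system (vmetric K),
    ProperFilter F -> cauchy F -> cvg F
}.

Section Boole.
Variables (R : realType) (K : ultrametricFieldType R).
Implicit Types (x z q t a lambda : K) (f : K -> K) (n N : nat).

(* f stands for a function on Z_p: only its values at natural numbers occur. *)
Definition fermionic_sum (p : nat) f N : K :=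
  \sum_(0 <= y < p ^ N) f y%:R * (-1) ^+ y.

Definition fermionic_integral (p : nat) f : K := vlim (fermionic_sum p f).

Definition qproduct q n z : K := \prod_(0 <= i < n) (z - i%:R * q).

Definition boole_integrand q lambda n x : K -> K :=
  fun y => qproduct q n (x + lambda * y).

Definition boole (p : nat) q lambda n x : K :=
  fermionic_integral p (boole_integrand q lambda n x).

Definition gbinom a n : K := (\prod_(0 <= i < n) (a - i%:R)) / n`!%:R.

Definition binomial_term q t a n : K := gbinom a n * q ^+ n * t ^+ n.

(* (1 + q t)^a *)
Definition binomial_power q t a : K := vlim (series (binomial_term q t a)).

Definition boole_term (p : nat) q lambda t x n : K :=
  boole p q lambda n x * (t ^+ n / n`!%:R).

(* F(t, x | lambda) *)
Definition boole_gen (p : nat) q lambda t x : K :=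
  vlim (series (boole_term p q lambda t x)).

End Boole.

(* Main.v *)
Require Import Defs.
From HB Require Import structures.
From mathcomp Require Import all_boot all_order all_algebra.
From mathcomp Require Import all_classical all_reals all_analysis.
From mathcomp Require Import ring.

(** Write [F x] for the generating function at [x] and [E x] for the binomial
    power [(1 + q t) ^ (x / q)], whose [n]-th term is [(x)_n t ^ n / n!] with
    [(x)_n] the [q]-product. The identity follows from two functional equations.

    - [F x = E x * F 0]. By the [q]-Vandermonde identity
      [(x + z)_n / n! = sum_k (x)_k / k! * (z)_(n - k) / (n - k)!]
      ([qbinomD]) and linearity of the fermionic integral, [F x] is the Cauchy
      product of [E x] and [F 0] ([booleD]). In an ultrametric field the Cauchy
      product of two convergent series always converges to the product of their
      sums ([cauchy_product]), so [x] only has to make [E x] converge.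

    - [F lambda + F 0 = 2]. The alternating sum of [f (y + 1) + f y] telescopes
      to [f 0 + f (p ^ N)], and [p ^ N] tends to [0], so the integrals of [f (y + 1)]
      and of [f] add up to [2 f 0] ([fermionic_integral_shift]). For the
      [q]-product of [lambda y] this says that the Boole polynomials at [lambda]
      and at [0] add up to [2] in degree [0] and to [0] in the other degrees.

    Together they give [(E lambda + 1) * F 0 = 2]. As [2 != 0], this shows both
    that [E lambda + 1 != 0] and that [F 0 = 2 / (E lambda + 1)].

    For convergence, [n!] has valuation at most [n / (p - 1)], that is,
    [|n!| >= r ^ n] with [r = p ^ (- 1 / (p - 1))]; since [|q| <= 1], the
    hypothesis on [t] gives [|t| < r], so that [u_n t ^ n / n!] is dominated by a
    geometric sequence whenever [|u_n| <= 1]. This applies to [u_n = (x)_n] with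
    [|x| <= 1] and to the Boole polynomials at [0], and a series whose terms tend
    to [0] converges in a complete ultrametric field. The fermionic sums of
    polynomials converge because the telescoping identity determines the sums of
    [y ^ n] from those of lower powers. *)

Set Implicit Arguments.
Unset Strict Implicit.
Unset Printing Implicit Defensive.

Import Order.TTheory GRing.Theory Num.Theory.

Local Open Scope classical_set_scope.
Local Open Scope ring_scope.

(** * Sequences and series in an ultrametric field *)

Section Ultrametric.
Variables (R : realType) (K : ultrametricFieldType R).
Implicit Types (x y l : K) (u v a d : nat -> K) (c e : R).

Lemma vnorm0 : vnorm (0 : K) = 0 :> R.
Proof. by apply/eqP; rewrite vnorm_eq0. Qed.

Lemma vnorm1 : vnorm (1 : K) = 1 :> R.
Proof.
have n1 : vnorm (1 : K) != 0 :> R by rewrite vnorm_eq0 oner_neq0.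
by apply: (mulfI n1); rewrite -vnormM !mulr1.
Qed.

Lemma vnormX x n : vnorm (x ^+ n) = vnorm x ^+ n.
Proof. by elim: n => [|n IH]; rewrite ?vnorm1 // !exprS vnormM IH. Qed.

Lemma vnormN x : vnorm (- x) = vnorm x.
Proof.
apply/eqP; rewrite -(@eqrXn2 _ 2%N) ?vnorm_ge0 //.
by rewrite -!vnormX sqrrN.
Qed.

Lemma vdistC x y : vnorm (x - y) = vnorm (y - x).
Proof. by rewrite -opprB vnormN. Qed.

Lemma vnormV x : vnorm x^-1 = (vnorm x)^-1.
Proof.
have [->|x0] := eqVneq x 0; first by rewrite invr0 vnorm0 invr0.
have nx0 : vnorm x != 0 :> R by rewrite vnorm_eq0.
by apply: (mulfI nx0); rewrite -vnormM !divff // vnorm1.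
Qed.

Lemma vnormD_le x y c : vnorm x <= c -> vnorm y <= c -> vnorm (x + y) <= c.
Proof. by move=> xc yc; rewrite (le_trans (vnormD_max _ _)) // ge_max xc. Qed.

Lemma vnormD_lt x y c : vnorm x < c -> vnorm y < c -> vnorm (x + y) < c.
Proof.
by move=> xc yc; rewrite (le_lt_trans (vnormD_max _ _)) // gt_max xc.
Qed.

Lemma vnormB_lt x y c : vnorm x < c -> vnorm y < c -> vnorm (x - y) < c.
Proof. by move=> xc yc; apply: vnormD_lt; rewrite ?vnormN. Qed.

Lemma vnorm_sum_le I (r : seq I) (P : pred I) (F : I -> K) c :
  0 <= c -> (forall i, P i -> vnorm (F i) <= c) ->
  vnorm (\sum_(i <- r | P i) F i) <= c.
Proof.
move=> c0 Fc; apply: (big_ind (fun x => vnorm x <= c)) => //.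
  by rewrite vnorm0.
by move=> x y; exact: vnormD_le.
Qed.

Lemma vnorm_sum_lt I (r : seq I) (P : pred I) (F : I -> K) c :
  0 < c -> (forall i, P i -> vnorm (F i) < c) ->
  vnorm (\sum_(i <- r | P i) F i) < c.
Proof.
move=> c0 Fc; apply: (big_ind (fun x => vnorm x < c)) => //.
  by rewrite vnorm0.
by move=> x y; exact: vnormD_lt.
Qed.

Lemma vnorm_prod_le1 I (r : seq I) (F : I -> K) :
  (forall i, vnorm (F i) <= 1 :> R) -> vnorm (\prod_(i <- r) F i) <= 1 :> R.
Proof.
move=> F1; apply: (big_ind (fun x => vnorm x <= 1 :> R)) => //.
  by rewrite vnorm1.
by move=> x y x1 y1; rewrite vnormM mulr_ile1 ?vnorm_ge0.
Qed.

Lemma vnorm_nat_le1 n : vnorm (n%:R : K) <= 1 :> R.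
Proof.
elim: n => [|n IH]; first by rewrite vnorm0 ler01.
by rewrite mulrSr vnormD_le // vnorm1.
Qed.

(** Convergence for the distance [|x - y|], phrased in [K] itself instead of its
    metric alias so that limits can be combined with the field operations. *)
Definition vto u l :=
  forall e : R, 0 < e -> \forall n \near \oo, vnorm (u n - l) < e.

Lemma vtoP u l : vto u l <-> ((u : nat -> vmetric K) @ \oo --> (l : vmetric K)).
Proof.
split=> [ul|/cvg_ballP ul e e0].
  apply/cvg_ballP => e e0; near=> n.
  rewrite ballEmdist /= /mdist /=.
  have : vnorm (u n - l) < e by near: n; exact: ul.
  by rewrite vdistC.
near=> n; rewrite vdistC.
by have : ball (l : vmetric K) e (u n) by near: n; exact: ul.
Unshelve. all: by end_near. Qed.

Lemma vto_lim u l : vto u l -> vlim u = l.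
Proof. by move=> /vtoP; apply: cvg_lim; exact: metric_hausdorff. Qed.

Lemma vto_cvg u l : vto u l -> vcvg u.
Proof. by move=> /vtoP ul; apply/cvg_ex; exists l. Qed.

Lemma vcvg_vto u : vcvg u -> vto u (vlim u).
Proof. by move=> ul; apply/vtoP. Qed.

Lemma vto_cst l : vto (fun=> l) l.
Proof. by move=> e e0; apply: nearW => n; rewrite subrr vnorm0. Qed.

Lemma vto_near u v l : (\forall n \near \oo, u n = v n) -> vto u l -> vto v l.
Proof.
move=> uv ul e e0; near=> n.
have <- : u n = v n by near: n.
by near: n; exact: ul.
Unshelve. all: by end_near. Qed.

Lemma vtoD u v l1 l2 :
  vto u l1 -> vto v l2 -> vto (fun n => u n + v n) (l1 + l2).
Proof.
move=> ul vl e e0; near=> n.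
rewrite opprD addrACA vnormD_lt //; near: n; [exact: ul|exact: vl].
Unshelve. all: by end_near. Qed.

Lemma vtoZ x u l : vto u l -> vto (fun n => x * u n) (x * l).
Proof.
have [-> _|x0 ul e e0] := eqVneq x 0.
  rewrite mul0r; apply: vto_near (vto_cst 0).
  by apply: nearW => n; rewrite mul0r.
have x0' : 0 < vnorm x :> R by rewrite lt_neqAle eq_sym vnorm_eq0 x0 vnorm_ge0.
near=> n; rewrite -mulrBr vnormM mulrC -ltr_pdivlMr //.
by near: n; apply: ul; rewrite divr_gt0.
Unshelve. all: by end_near. Qed.

Lemma vto_sum I (r : seq I) (F : I -> nat -> K) (l : I -> K) :
  (forall i, vto (F i) (l i)) ->
  vto (fun n => \sum_(i <- r) F i n) (\sum_(i <- r) l i).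
Proof.
move=> Fl; elim: r => [|i r IH].
  rewrite big_nil; apply: vto_near (vto_cst 0).
  by apply: nearW => n; rewrite big_nil.
rewrite big_cons; apply: vto_near (vtoD (Fl i) IH).
by apply: nearW => n; rewrite big_cons.
Qed.

Lemma vto_unique u l1 l2 : vto u l1 -> vto u l2 -> l1 = l2.
Proof. by move=> /vto_lim <- /vto_lim <-. Qed.

Lemma vto_bounded u l :
  vto u l -> exists2 c : R, 0 < c & forall n, vnorm (u n) <= c.
Proof.
move=> /(_ 1 ltr01)[N _ uN].
pose s : R := \sum_(i < N) vnorm (u i).
have s0 : 0 <= s by apply: sumr_ge0 => i _; exact: vnorm_ge0.
have l0 : 0 <= vnorm l :> R := vnorm_ge0 _.
exists (1 + s + vnorm l); first by rewrite -addrA ltr_wpDr // addr_ge0.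
move=> n; have [nN|Nn] := ltnP n N.
  have : vnorm (u n) <= s.
    rewrite /s (bigD1 (Ordinal nN)) //= lerDl.
    by apply: sumr_ge0 => i _; exact: vnorm_ge0.
  move=> /le_trans; apply; rewrite -addrA addrCA lerDl addr_ge0 //.
rewrite -(subrK l (u n)) vnormD_le //.
  apply: le_trans (ltW (uN n Nn)) _.
  by rewrite -addrA lerDl addr_ge0.
by rewrite lerDr addr_ge0.
Qed.

Lemma vto_norm_le u l c : vto u l -> (forall n, vnorm (u n) <= c) ->
  vnorm l <= c.
Proof.
move=> ul uc; have [//|cl] := leP (vnorm l) c.
have l0 : 0 < vnorm l :> R.
  by apply: le_lt_trans cl; apply: le_trans (vnorm_ge0 _) (uc 0%N).
have [N _ /(_ N (leqnn N)) uN] := ul _ l0.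
suff : vnorm l < vnorm l :> R by rewrite ltxx.
rewrite -[X in vnorm X < _](subKr (u N)) vnormB_lt //.
exact: le_lt_trans cl.
Qed.

Lemma null_geometric u c : 0 <= c < 1 -> (forall n, vnorm (u n) <= c ^+ n) ->
  vto u 0.
Proof.
move=> /andP[c0 c1] uc e e0.
have := @cvg_expr R c; rewrite ger0_norm // => /(_ c1) /cvgrPdist_lt /(_ e e0).
move=> ce; near=> n; rewrite subr0 (le_lt_trans (uc n)) //.
have : `|0 - c ^+ n| < e by near: n.
by rewrite sub0r normrN ger0_norm // exprn_ge0.
Unshelve. all: by end_near. Qed.

Lemma series_null u l : vto (series u) l -> vto u 0.
Proof.
move=> ul e e0; have [N _ uN] := ul e e0; exists N => // n /= Nn.
have -> : u n - 0 = (series u n.+1 - l) - (series u n - l).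
  rewrite opprB addrA subrK subr0 /series /= big_nat_recr //=.
  by rewrite addrAC subrr add0r.
by apply: vnormB_lt; apply: uN => //=; exact: leqW.
Qed.

(** The tail of an ultrametric series is bounded by its largest term, so the
    partial sums are Cauchy as soon as the terms tend to [0]. *)
Lemma series_cvg u :
  (forall F : set_system (vmetric K), ProperFilter F -> cauchy F -> cvg F) ->
  vto u 0 -> vcvg (series u).
Proof.
move=> complete u0; apply: complete; apply: cauchy_exP => e e0.
have [N _ uN] := u0 e e0; exists (series u N : vmetric K).
exists N => // n /= Nn; rewrite ballEmdist /= /mdist /= vdistC.
rewrite /series /= (big_cat_nat (leq0n _) Nn) //= addrAC subrr add0r.
rewrite big_nat_cond; apply: vnorm_sum_lt => // i /andP[/andP[Ni _] _].
by have := uN i Ni; rewrite subr0.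
Qed.

(** Either index of [a k * d (n - k)] is at least [n / 2], so one factor is small
    while the other stays bounded, and an ultrametric sum is no larger than its
    largest term. *)
Lemma conv_null a d : vto a 0 -> vto d 0 ->
  vto (fun n => \sum_(k < n) a k * d (n - k)%N) 0.
Proof.
move=> a0 d0.
have [A A0 aA] := vto_bounded a0; have [B B0 dB] := vto_bounded d0.
move=> e e0.
have [N1 _ aN] := a0 _ (divr_gt0 e0 B0).
have [N2 _ dN] := d0 _ (divr_gt0 e0 A0).
exists (N1 + N2)%N => // n /= Nn; rewrite subr0.
apply: vnorm_sum_lt => // k _; rewrite vnormM.
have [N1k|kN1] := leqP N1 k.
  have := aN k N1k; rewrite subr0 ltr_pdivlMr //; apply: le_lt_trans.
  by rewrite ler_wpM2l ?vnorm_ge0.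
have := dN (n - k)%N; rewrite subr0 ltr_pdivlMr // mulrC => dk.
apply: le_lt_trans (dk _).
  by rewrite ler_wpM2r ?vnorm_ge0.
rewrite /= leq_subRL; last exact: ltnW.
by apply: leq_trans Nn; rewrite leq_add2r ltnW.
Qed.

(** The [n]-th partial sum of the Cauchy product is the convolution of [u] with
    the partial sums of [v], so it differs from [V * series u n] by the
    convolution of the null sequences [u] and [series v - V]. *)
Lemma cauchy_product u v U V : vto (series u) U -> vto (series v) V ->
  vto (series (fun n => \sum_(k < n.+1) u k * v (n - k)%N)) (U * V).
Proof.
move=> uU vV.
pose d n := series v n - V.
have d0 : vto d 0.
  by rewrite -(subrr V); apply: vtoD => //; exact: vto_cst.
have E n : series (fun n => \sum_(k < n.+1) u k * v (n - k)%N) n =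
           V * series u n + \sum_(k < n) u k * d (n - k)%N.
  transitivity (\sum_(k < n) u k * series v (n - k)%N); last first.
    rewrite /series /= big_mkord mulr_sumr -big_split /=.
    by apply: eq_bigr => k _; rewrite /d mulrBr [V * _]mulrC addrC subrK.
  elim: n => [|n IH]; first by rewrite /series /= big_geq // big_ord0.
  rewrite /series /= big_nat_recr //=.
  have -> : \sum_(0 <= i < n) \sum_(k < i.+1) u k * v (i - k)%N =
            \sum_(k < n.+1) u k * series v (n - k)%N.
    move: IH; rewrite {1}/series /= => ->.
    by rewrite big_ord_recr /= subnn {3}/series /= big_geq // mulr0 addr0.
  rewrite -big_split /=; apply: eq_bigr => k _; rewrite -mulrDr; congr (_ * _).
  by rewrite subSn ?leq_ord // /series /= big_nat_recr.
have := vtoD (vtoZ V uU) (conv_null (series_null uU) d0).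
rewrite addr0 mulrC; apply: vto_near.
by apply: nearW => n; rewrite E.
Qed.

End Ultrametric.

(** * The size of factorials *)

(** Taking out the term [k = 1] leaves the same sum for [n %/ p], which
    contributes at most [n %/ p] by induction, and
    [(p - 1) (n %/ p) + n %/ p <= n]. *)
Lemma sum_divn_expn p m n : (0 < p)%N ->
  (p.-1 * \sum_(1 <= k < m.+1) n %/ p ^ k <= n)%N.
Proof.
move=> p0; elim: m n => [|m IH] n; first by rewrite big_geq // muln0.
rewrite big_nat_recl // expn1 big_add1 /=.
under eq_big_nat => k _ do rewrite expnS divnMA.
rewrite mulnDr.
apply: leq_trans (leq_divM n p).
have -> : (n %/ p * p = p.-1 * (n %/ p) + n %/ p)%N.
  by rewrite [RHS]addnC -mulSn prednK // mulnC.
rewrite leq_add2l.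
by move: (IH (n %/ p)%N); rewrite [in X in X -> _]big_add1.
Qed.

Lemma logn_fact_le p n : prime p -> (p.-1 * logn p n`! <= n)%N.
Proof. by move=> pp; rewrite logn_fact // sum_divn_expn ?prime_gt0. Qed.

Section Padic.
Variables (p : nat) (R : realType) (K : ultrametricFieldType R).
Hypotheses (p_prime : prime p) (norm_p : vnorm (p%:R : K) = p%:R^-1 :> R).

(** The radius of convergence of the exponential series. *)
Definition radius : R := p%:R `^ (- (p%:R - 1)^-1).

Lemma norm_p_lt1 : vnorm (p%:R : K) < 1 :> R.
Proof. by rewrite norm_p invf_lt1 ?ltr1n ?ltr0n ?prime_gt1 ?prime_gt0. Qed.

(** A Bezout relation [a p - b m = 1] and [|p| < 1] would give [|1| < 1] if
    [|m| < 1]. *)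
Lemma vnorm_coprime m : coprime p m -> vnorm (m%:R : K) = 1 :> R.
Proof.
move=> pm; apply/eqP; rewrite eq_le vnorm_nat_le1 leNgt; apply/negP => m1.
have /(coprimeP _ (prime_gt0 p_prime))[[a b] /= ab] := pm.
have : vnorm ((a * p)%:R - (b * m)%:R : K) < 1 :> R.
  apply: vnormB_lt; rewrite natrM vnormM.
    apply: le_lt_trans norm_p_lt1.
    by rewrite ler_piMl ?vnorm_ge0 ?vnorm_nat_le1.
  by apply: le_lt_trans m1; rewrite ler_piMl ?vnorm_ge0 ?vnorm_nat_le1.
rewrite -natrB; last by rewrite ltnW // -subn_gt0 ab.
by rewrite ab vnorm1 ltxx.
Qed.

Lemma radius_gt0 : 0 < radius.
Proof. by rewrite powR_gt0 // ltr0n prime_gt0. Qed.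

Lemma radius_le1 : radius <= 1.
Proof.
rewrite -(powRr0 (p%:R : R)) ler_powR ?ler1n ?prime_gt0 //.
by rewrite oppr_le0 invr_ge0 subr_ge0 ler1n prime_gt0.
Qed.

Lemma radiusX : radius ^+ p.-1 = p%:R^-1.
Proof.
rewrite -powR_mulrn ?ltW ?radius_gt0 // /radius -powRrM.
rewrite -subn1 natrB ?prime_gt0 // mulNr mulVf ?powR_inv1 ?ler0n //.
by rewrite subr_eq0 pnatr_eq1 gtn_eqF ?prime_gt1.
Qed.

Lemma vnorm_fact_ge n : radius ^+ n <= vnorm (n`!%:R : K).
Proof.
have [m pm ->] := pfactor_coprime p_prime (fact_gt0 n).
rewrite natrM vnormM vnorm_coprime // mul1r natrX vnormX norm_p -radiusX -exprM.
by rewrite ler_wiXn2l ?logn_fact_le ?radius_le1 ?ltW ?radius_gt0.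
Qed.

Lemma fact_neq0 n : n`!%:R != 0 :> K.
Proof.
rewrite -(@vnorm_eq0 R) gt_eqF //.
by apply: lt_le_trans (vnorm_fact_ge n); rewrite exprn_gt0 ?radius_gt0.
Qed.

Lemma natr_neq0 n : n.+1%:R != 0 :> K.
Proof.
by have := fact_neq0 n.+1; rewrite factS natrM mulf_eq0 negb_or => /andP[].
Qed.

Lemma null_exp_over_fact (u : nat -> K) (t : K) :
  vnorm t < radius -> (forall n, vnorm (u n) <= 1 :> R) ->
  vto (fun n => u n * (t ^+ n / n`!%:R)) 0.
Proof.
move=> tr u1; apply: (@null_geometric _ _ _ (vnorm t / radius)).
  rewrite divr_ge0 ?vnorm_ge0 ?(ltW radius_gt0) //=.
  by rewrite ltr_pdivrMr ?radius_gt0 // mul1r.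
move=> n; rewrite !vnormM vnormV vnormX expr_div_n.
rewrite -[leRHS]mul1r ler_pM // ?mulr_ge0 ?invr_ge0 ?exprn_ge0 ?vnorm_ge0 //.
rewrite ler_wpM2l ?exprn_ge0 ?vnorm_ge0 // lef_pV2 ?vnorm_fact_ge //.
  by rewrite posrE lt_neqAle eq_sym vnorm_eq0 fact_neq0 vnorm_ge0.
by rewrite posrE exprn_gt0 ?radius_gt0.
Qed.

(** * Fermionic sums of polynomials *)

Section FermionicSum.
Hypothesis p_odd : odd p.
Implicit Types (f g : K -> K) (P : {poly K}).

Lemma fermionic_sum_norm_le f N (c : R) :
  (forall y, vnorm (f y%:R) <= c) -> vnorm (fermionic_sum p f N) <= c.
Proof.
move=> fc; have c0 : 0 <= c := le_trans (vnorm_ge0 _) (fc 0%N).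
apply: vnorm_sum_le => // y _.
by rewrite vnormM vnormX vnormN vnorm1 expr1n mulr1.
Qed.

Lemma fermionic_sum_lin I (r : seq I) (a : I -> K) (g : I -> K -> K) f N :
  (forall y, f y%:R = \sum_(i <- r) a i * g i y%:R) ->
  fermionic_sum p f N = \sum_(i <- r) a i * fermionic_sum p (g i) N.
Proof.
move=> fE; rewrite /fermionic_sum.
under eq_bigr => y _ do rewrite fE mulr_suml.
rewrite exchange_big /=; apply: eq_bigr => i _; rewrite mulr_sumr.
by apply: eq_bigr => y _; rewrite mulrA.
Qed.

(** The sum over [y] of [(-1)^y (f (y + 1) + f y)] telescopes; the sign of the
    last term is [-1] because [p ^ N] is odd. *)
Lemma fermionic_sum_shift f N :
  fermionic_sum p (fun y => f (y + 1)) N + fermionic_sum p f N =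
  f 0 + f (p ^ N)%:R.
Proof.
have tele M : \sum_(0 <= y < M) f (y%:R + 1) * (-1) ^+ y +
              \sum_(0 <= y < M) f y%:R * (-1) ^+ y = f 0 - (-1) ^+ M * f M%:R.
  elim: M => [|M IH]; first by rewrite !big_geq // mul1r subrr addr0.
  rewrite !big_nat_recr //= addrACA IH exprS mulN1r mulNr opprK natr1.
  rewrite [f M.+1%:R * _]mulrC [f M%:R * _]mulrC.
  by rewrite [X in _ + X = _]addrC addrA subrK.
by rewrite /fermionic_sum tele -signr_odd oddX p_odd orbT mulN1r opprK.
Qed.

Lemma natr_expp_null i : (0 < i)%N -> vto (fun N => (p ^ N)%:R ^+ i : K) 0.
Proof.
move=> i0; apply: (@null_geometric _ _ _ (p%:R^-1)).
  by rewrite -norm_p vnorm_ge0 norm_p_lt1.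
move=> N; rewrite -norm_p vnormX natrX vnormX -exprM.
rewrite ler_wiXn2l ?vnorm_ge0 ?(ltW norm_p_lt1) //.
by rewrite leq_pmulr.
Qed.

Lemma horner_expp_vto P : vto (fun N => P.[(p ^ N)%:R]) P.[0].
Proof.
have E N : P.[(p ^ N)%:R] = \sum_(i < size P) P`_i * (p ^ N)%:R ^+ i.
  by rewrite horner_coef.
rewrite [P.[0]]horner_coef.
apply: vto_near (vto_sum
  (F := fun (i : 'I_(size P)) N => P`_i * (p ^ N)%:R ^+ i) _ _).
  by apply: nearW => N; rewrite E.
move=> [[|i] iP] /=; apply: vtoZ.
  rewrite expr0; apply: vto_near (vto_cst 1).
  by apply: nearW => N; rewrite expr0.
by rewrite expr0n /=; exact: natr_expp_null.
Qed.

(** Applying the shift to [y ^ n] and expanding [(y + 1) ^ n] yields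
    [2 S_N(y ^ n)] as [0 ^ n + (p ^ N) ^ n] minus a combination of the sums of
    lower powers; the right-hand side converges by induction on [n]. *)
Lemma fermionic_sum_exp_cvg n :
  vcvg (fermionic_sum p (fun y : K => y ^+ n)).
Proof.
elim/ltn_ind: n => n IH.
pose S i N := fermionic_sum p (fun y : K => y ^+ i) N.
have E N : S n N = 2^-1 * ((('X^n).[0] + ('X^n).[(p ^ N)%:R]) +
    - 1 * \sum_(i < n) 'C(n, i)%:R * S i N).
  have := fermionic_sum_shift (fun y => y ^+ n) N.
  rewrite (@fermionic_sum_lin _ (index_enum 'I_n.+1) (fun i => 'C(n, i)%:R)
    (fun i y => y ^+ i)); last first.
    move=> y; rewrite addrC exprDn; apply: eq_bigr => i _.
    by rewrite expr1n mul1r mulr_natl.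
  rewrite big_ord_recr /= binn mul1r !hornerXn => <-.
  rewrite mulN1r -[X in X - _]addrA [X in X - _]addrC addrK.
  by rewrite -mulr2n -[X in _ * X]mulr_natl mulKf ?natr_neq0.
have Sl (i : 'I_n) :
    vto (fun N => 'C(n, i)%:R * S i N) ('C(n, i)%:R * vlim (S i)).
  by apply: vtoZ; apply: vcvg_vto; exact: IH.
apply/vto_cvg; apply: vto_near (vtoZ 2^-1 (vtoD
  (vtoD (vto_cst _) (horner_expp_vto 'X^n))
  (vtoZ (-1) (vto_sum (index_enum 'I_n) Sl)))).
by apply: nearW => N; rewrite [RHS]E.
Qed.

Lemma fermionic_sum_poly_cvg P : vcvg (fermionic_sum p (fun y => P.[y])).
Proof.
have Sl (i : 'I_(size P)) := vtoZ P`_i (vcvg_vto (@fermionic_sum_exp_cvg i)).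
apply/vto_cvg; apply: vto_near (vto_sum (index_enum _) Sl).
apply: nearW => N; apply/esym/fermionic_sum_lin => y.
by rewrite horner_coef.
Qed.

Lemma fermionic_sum_poly_vto f P : f =1 horner P ->
  vto (fermionic_sum p f) (fermionic_integral p f).
Proof. by move=> /funext ->; apply: vcvg_vto; exact: fermionic_sum_poly_cvg. Qed.

Lemma fermionic_integral_shift f P : f =1 horner P ->
  fermionic_integral p (fun y => f (y + 1)) + fermionic_integral p f = 2 * f 0.
Proof.
move=> fP.
have gP : (fun y => f (y + 1)) =1 horner (P \Po ('X + 1)).
  by move=> y; rewrite horner_comp hornerD hornerX hornerC fP.
apply: vto_unique (vtoD (fermionic_sum_poly_vto gP) (fermionic_sum_poly_vto fP)) _.
rewrite mulr_natl mulr2n.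
apply: vto_near (vtoD (vto_cst _) (_ : vto (fun N => f (p ^ N)%:R) (f 0))).
  by apply: nearW => N; rewrite fermionic_sum_shift.
by rewrite (funext fP); exact: horner_expp_vto.
Qed.

End FermionicSum.
End Padic.

(** * The [q]-product *)

Section QProduct.
Variables (R : realType) (K : ultrametricFieldType R) (q : K).
Implicit Types (x y z : K).

Lemma qproductS n z : qproduct q n.+1 z = qproduct q n z * (z - n%:R * q).
Proof. by rewrite /qproduct big_nat_recr. Qed.

Lemma qproduct0 z : qproduct q 0 z = 1.
Proof. by rewrite /qproduct big_geq. Qed.

Lemma qproduct_at0 n : qproduct q n 0 = (n == 0%N)%:R.
Proof.
case: n => [|n]; first by rewrite qproduct0.
by rewrite /qproduct big_nat_recl // mul0r subrr mul0r.
Qed.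

Lemma qproduct_le1 n z : vnorm q <= 1 :> R -> vnorm z <= 1 :> R ->
  vnorm (qproduct q n z) <= 1 :> R.
Proof.
move=> q1 z1; apply: vnorm_prod_le1 => i; apply: vnormD_le => //.
by rewrite vnormN vnormM mulr_ile1 ?vnorm_ge0 ?vnorm_nat_le1.
Qed.

Lemma boole_integrand_poly (lambda : K) n x :
  boole_integrand q lambda n x =1
  horner (\prod_(0 <= i < n) (lambda *: 'X + (x - i%:R * q)%:P)).
Proof.
move=> y; rewrite /boole_integrand /qproduct horner_prod.
apply: eq_bigr => i _.
by rewrite hornerD hornerZ hornerX hornerC addrCA addrA.
Qed.

Definition qbinom n z := qproduct q n z / n`!%:R.

Hypothesis char0 : forall n, n.+1%:R != 0 :> K.

Lemma qbinomS n z : n.+1%:R * qbinom n.+1 z = qbinom n z * (z - n%:R * q).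
Proof.
by rewrite /qbinom qproductS factS natrM invfM mulrCA mulVKf // mulrAC.
Qed.

(** The [q]-Vandermonde identity. Splitting the last factor of degree [n + 1] as
    [x + z - n q = (x - k q) + (z - (n - k) q)] raises the degree of one factor
    of each product; the products so obtained carry the weights [k] and
    [n + 1 - k], which add up to [n + 1]. *)
Lemma qbinomD n x z :
  qbinom n (x + z) = \sum_(k < n.+1) qbinom k x * qbinom (n - k) z.
Proof.
elim: n => [|n IH].
  by rewrite big_ord1 /qbinom !qproduct0 fact0 divr1 mulr1.
apply: (mulfI (char0 n)); rewrite qbinomS IH mulr_suml.
have E : \sum_(k < n.+2) n.+1%:R * (qbinom k x * qbinom (n.+1 - k) z) =
  \sum_(k < n.+2) k%:R * qbinom k x * qbinom (n.+1 - k) z +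
  \sum_(k < n.+2) qbinom k x * ((n.+1 - k)%:R * qbinom (n.+1 - k) z).
  rewrite -big_split /=; apply: eq_bigr => k _.
  rewrite -mulrA [X in _ + X]mulrCA -mulrDl -natrD subnKC //.
  by rewrite -ltnS; exact: ltn_ord.
rewrite mulr_sumr E [X in _ = X + _]big_ord_recl /= !mul0r add0r.
rewrite [X in _ = _ + X]big_ord_recr /= subnn mulr0n mul0r mulr0.
rewrite addr0 -big_split /=; apply: eq_bigr => k _.
have kn : (k <= n)%N := leq_ord k.
rewrite /bump /= add1n subSS qbinomS subSn // qbinomS natrB //.
ring.
Qed.

End QProduct.

(** * The generating function *)

Section Generating.
Variables (p : nat) (R : realType) (K : ultrametricFieldType R).
Variables (q lambda : K).
Hypotheses (p_prime : prime p) (p_odd : odd p).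
Hypothesis norm_p : vnorm (p%:R : K) = p%:R^-1 :> R.

Let n_neq0 := natr_neq0 p_prime norm_p.
Let fact_n0 := fact_neq0 p_prime norm_p.

Lemma boole_vto n x :
  vto (fermionic_sum p (boole_integrand q lambda n x)) (boole p q lambda n x).
Proof.
exact: (fermionic_sum_poly_vto p_prime norm_p p_odd
  (@boole_integrand_poly _ _ _ _ _ _)).
Qed.

(** The integral is linear, so the [q]-Vandermonde expansion of
    [x + (0 + lambda y)] passes under it. *)
Lemma booleD n x :
  boole p q lambda n x / n`!%:R =
  \sum_(k < n.+1) qbinom q k x * (boole p q lambda (n - k) 0 / (n - k)`!%:R).
Proof.
pose S m x N := fermionic_sum p (boole_integrand q lambda m x) N.
have SE N : \sum_(k < n.+1) (n`!%:R * (qbinom q k x / (n - k)`!%:R)) *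
    S (n - k)%N 0 N = S n x N.
  apply/esym/fermionic_sum_lin => y.
  transitivity (n`!%:R * qbinom q n (x + lambda * y%:R)).
    by rewrite /qbinom mulrC divfK.
  rewrite qbinomD // mulr_sumr; apply: eq_bigr => k _.
  by rewrite /boole_integrand add0r /qbinom; ring.
have Sl := vto_sum (index_enum 'I_n.+1) (fun k : 'I_n.+1 =>
    vtoZ (n`!%:R * (qbinom q k x / (n - k)`!%:R)) (@boole_vto (n - k)%N 0)).
rewrite (vto_unique (@boole_vto n x) (vto_near _ Sl)).
  rewrite mulr_suml; apply: eq_bigr => k _.
  by rewrite -mulrA mulrC; field; rewrite !fact_n0.
by apply: nearW => N; rewrite -/(S _ _ _) -SE.
Qed.

(** [(0 + lambda (y + 1)) = lambda + lambda y], so this is the shift equation of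
    the fermionic integral. *)
Lemma boole_shift n :
  boole p q lambda n lambda + boole p q lambda n 0 = 2 * (n == 0%N)%:R.
Proof.
have := fermionic_integral_shift p_prime norm_p p_odd
  (@boole_integrand_poly _ _ q lambda n 0).
have -> : (fun y => boole_integrand q lambda n 0 (y + 1)) =
    boole_integrand q lambda n lambda.
  apply/funext => y.
  by rewrite /boole_integrand add0r mulrDr mulr1 addrC.
by rewrite {3}/boole_integrand mulr0 addr0 qproduct_at0.
Qed.

Lemma boole_norm_le1 n x : vnorm q <= 1 :> R -> vnorm lambda <= 1 :> R ->
  vnorm x <= 1 :> R -> vnorm (boole p q lambda n x) <= 1 :> R.
Proof.
move=> q1 l1 x1; apply: vto_norm_le (@boole_vto n x) _ => N.
apply: fermionic_sum_norm_le => y; apply: qproduct_le1 => //.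
apply: vnormD_le => //.
by rewrite vnormM mulr_ile1 ?vnorm_ge0 ?vnorm_nat_le1.
Qed.

Variable t : K.

Lemma binomial_termE x n : q != 0 ->
  binomial_term q t (x / q) n = qproduct q n x * (t ^+ n / n`!%:R).
Proof.
move=> q0; rewrite /binomial_term /gbinom.
have -> : qproduct q n x = (\prod_(0 <= i < n) (x / q - i%:R)) * q ^+ n.
  rewrite -[n in q ^+ n]subn0 -prodr_const_nat -big_split /=.
  by apply: eq_bigr => i _; rewrite mulrBl divfK.
by rewrite -!mulrA; congr (_ * _); rewrite mulrCA; congr (_ * _); rewrite mulrC.
Qed.

Lemma boole_termD n x : q != 0 ->
  boole_term p q lambda t x n =
  \sum_(k < n.+1) binomial_term q t (x / q) k *
    boole_term p q lambda t 0 (n - k)%N.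
Proof.
move=> q0; rewrite /boole_term mulrCA booleD mulr_sumr.
apply: eq_bigr => k _; rewrite binomial_termE // /qbinom.
have -> : t ^+ n = t ^+ k * t ^+ (n - k) by rewrite -exprD subnKC // leq_ord.
by ring.
Qed.

(** By [boole_termD] the series on the left is a Cauchy product. *)
Lemma boole_gen_factor x G : q != 0 ->
  vto (series (boole_term p q lambda t 0)) G ->
  vcvg (series (binomial_term q t (x / q))) ->
  vto (series (boole_term p q lambda t x)) (binomial_power q t (x / q) * G).
Proof.
move=> q0 F0 /vcvg_vto ex.
rewrite (_ : boole_term p q lambda t x = fun n => \sum_(k < n.+1)
  binomial_term q t (x / q) k * boole_term p q lambda t 0 (n - k)%N).
  exact: cauchy_product ex F0.
by apply/funext => n; exact: boole_termD.
Qed.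

(** Adding up the shift equations against [t ^ n / n!]. *)
Lemma boole_gen_shift G1 G0 :
  vto (series (boole_term p q lambda t lambda)) G1 ->
  vto (series (boole_term p q lambda t 0)) G0 -> G1 + G0 = 2.
Proof.
move=> F1 F0; apply: vto_unique (vtoD F1 F0) (vto_near _ (vto_cst 2)).
exists 1%N => // -[//|n] _ /=.
rewrite /series /= -big_split /= big_nat_recl // big1 => [|i _].
  by rewrite /boole_term -mulrDl boole_shift mulr1 expr0 fact0 divr1 mulr1 addr0.
by rewrite /boole_term -mulrDl boole_shift mulr0 mul0r.
Qed.

End Generating.

Theorem theorem2p1 (p : nat) (R : realType) (K : ultrametricFieldType R)
    (p_prime : prime p) (p_odd : odd p) (K_Cp : is_Cp p K) (lambda q t : K)
    (lambda_Zp : padic_int lambda)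
    (q_near1 : vnorm (1 - q) < p%:R `^ (- (p%:R - 1)^-1))
    (t_small : vnorm t < p%:R `^ (- (p%:R - 1)^-1) * vnorm q) :
  [/\ forall n (x : K), vcvg (fermionic_sum p (boole_integrand q lambda n x)),
      vcvg (series (binomial_term q t (lambda / q))),
      binomial_power q t (lambda / q) + 1 != 0,
      forall x : K, vnorm x <= 1 -> vcvg (series (binomial_term q t (x / q))) &
      forall x : K, vcvg (series (binomial_term q t (x / q))) ->
        vcvg (series (boole_term p q lambda t x)) /\
        boole_gen p q lambda t x =
          2 / (binomial_power q t (lambda / q) + 1) *
          binomial_power q t (x / q)].
Proof.
have norm_p := Cp_norm_p K_Cp.
have complete := Cp_complete K_Cp.
have lambda1 : vnorm lambda <= 1 by case: lambda_Zp.
have rp : 0 < p%:R `^ (- (p%:R - 1)^-1) :> R := radius_gt0 R p_prime.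
have q1 : vnorm q <= 1.
  rewrite -(subKr 1 q) vnormD_le ?vnorm1 // vnormN.
  apply: le_trans (ltW q_near1) _.
  exact: (radius_le1 R p_prime).
have q0 : q != 0.
  apply: contraTneq t_small => ->.
  by rewrite vnorm0 mulr0 -leNgt vnorm_ge0.
have t_radius : vnorm t < radius p R.
  exact: lt_le_trans t_small (ler_piMr (ltW rp) q1).
have power_cvg x : vnorm x <= 1 -> vcvg (series (binomial_term q t (x / q))).
  move=> x1; apply: series_cvg => //.
  rewrite (funext (fun n => binomial_termE t x n q0)).
  apply: (null_exp_over_fact p_prime norm_p) => // n.
  exact: qproduct_le1.
have F0 : vto (series (boole_term p q lambda t 0)) (boole_gen p q lambda t 0).
  apply: vcvg_vto; apply: series_cvg => //.
  apply: (null_exp_over_fact p_prime norm_p) => // n.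
  by apply: boole_norm_le1; rewrite ?vnorm0 ?ler01.
have F x := boole_gen_factor p_prime p_odd norm_p (x := x) q0 F0.
have E2 : (binomial_power q t (lambda / q) + 1) * boole_gen p q lambda t 0 = 2.
  rewrite mulrDl mul1r.
  exact (boole_gen_shift p_prime p_odd norm_p (F _ (power_cvg _ lambda1)) F0).
have D0 : binomial_power q t (lambda / q) + 1 != 0.
  apply/eqP => D0; have := natr_neq0 p_prime norm_p 1.
  by rewrite -E2 D0 mul0r eqxx.
split=> // [n x||x ex]; first 1 last.
- exact: power_cvg.
- split; first exact: vto_cvg (F _ ex).
  by rewrite /boole_gen (vto_lim (F _ ex)) -E2 mulrC [X in _ = X * _]mulrC mulKf.
exact: vto_cvg (boole_vto _ _ _ _ _ _ _).
Qed.
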